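(* Let $P^{ij}=\partial_x\, g^{ij}\,\partial_x$ be a non-degenerate second-order homogeneous Hamiltonian operator in canonical form in $n$ dependent variables $u^1,\dots,u^n$, so that the inverse matrix $(g_{ij})$ of $(g^{ij})$ is $g_{ij}=T_{ijk}u^k+g^0_{ij}$, with $T_{ijk}$ constant and totally skew-symmetric and $g^0_{ij}$ constant and skew-symmetric. Then for every projective reciprocal transformation $$\tilde u^i=\frac{a^i_ju^j+a^i_{n+1}}{A},\qquad d\tilde x=A\,dx,\qquad A=a^{n+1}_ju^j+a^{n+1}_{n+1},\qquad (a^\lambda_\mu)\in SL(n+1,\mathbb{C}),$$ the operator $P$ is transformed into an operator $\tilde P^{kl}=\partial_{\tilde x}\,\tilde g^{kl}\,\partial_{\tilde x}$ of the same canonical form. That is, the inverse matrix of $(\tilde g^{kl})$ is $\tilde g_{kl}=\tilde T_{klm}\tilde u^m+\tilde g^0_{kl}$, with $\tilde T_{klm}$ constant and totally skew-symmetric and $\tilde g^0_{kl}$ constant and skew-symmetric. In other words, second-order homogeneous Hamiltonian operators are invariant under projective reciprocal transformations.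
   Context: Summation over repeated indices is understood; latin indices run over $1,\dots,n$. The $u^i=u^i(t,x)$ are the dependent variables, $\partial_x$ is the total $x$-derivative, and everything is considered on the open set where $A\neq0$ and $\det(g_{ij})\neq 0$. A (non-degenerate) second-order homogeneous Hamiltonian operator in canonical form (i.e. in flat coordinates) is a matrix differential operator $P^{ij}=\partial_x g^{ij}\partial_x$, where $(g^{ij}(u))$ is the inverse of an invertible matrix $g_{ij}=T_{ijk}u^k+g^0_{ij}$ with $T_{ijk}$ constant and skew-symmetric in $i,j,k$ and $g^0_{ij}$ constant and skew-symmetric in $i,j$. Action of the transformation on operators: densities $F=\int f(u)\,dx$ are rewritten as $F=\int\tilde f(\tilde u)\,d\tilde x$, i.e. $f=A\tilde f$, and the total derivatives are related by $\partial_x=A\,\partial_{\tilde x}$. The operator $P$ is transformed into $\tilde P$ if, for all functions $f(u),h(u)$, $$\int \frac{\partial f}{\partial u^i}\,P^{ij}\,\frac{\partial h}{\partial u^j}\,dx=\int\frac{\partial\tilde f}{\partial\tilde u^k}\,\tilde P^{kl}\,\frac{\partial\tilde h}{\partial\tilde u^l}\,d\tilde x,$$ where integrals are taken modulo total derivatives, i.e. the difference $\frac{\partial f}{\partial u^i}P^{ij}\frac{\partial h}{\partial u^j}-A\,\frac{\partial\tilde f}{\partial\tilde u^k}\tilde P^{kl}\frac{\partial\tilde h}{\partial\tilde u^l}$ is a total $x$-derivative. *)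

(* Defs.v *)
From HB Require Import structures.
From mathcomp Require Import all_boot all_order all_algebra.
From mathcomp Require Import all_classical all_reals all_analysis.
From mathcomp Require Export complex.
Set Implicit Arguments.
Unset Strict Implicit.
Unset Printing Implicit Defensive.
Import Order.TTheory GRing.Theory Num.Theory.
Import numFieldNormedType.Exports.
Local Open Scope classical_set_scope.
Local Open Scope ring_scope.

(* The intended instance of K below is R[i] with R : realType. *)

Section Smooth.
Variables (K : numFieldType) (m n : nat).

Definition pderiv (f : 'M[K]_(m, n) -> K) (p : 'I_m * 'I_n) :
    'M[K]_(m, n) -> K :=
  fun x => 'D_(delta_mx p.1 p.2) f x.

(* All iterated partial derivatives exist and are differentiable over K on V.
   For K = R[i] and V open these are the holomorphic functions on V. *)
Definition smooth_on (V : set 'M[K]_(m, n)) (f : 'M[K]_(m, n) -> K) : Prop :=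
  forall s : seq ('I_m * 'I_n), forall x, V x -> differentiable (foldl pderiv f s) x.

End Smooth.

Section Jets.
Variables (K : numFieldType) (n : nat).

(* The coordinates (j a) 0 i stand for the a-th x-derivative of u^i; in
   particular j 0 is the point u. *)
Definition jet : Type := nat -> 'rV[K]_n.

Definition jet_fun : Type := jet -> K.

Definition jet_trunc (k : nat) (j : jet) : 'M[K]_(k.+1, n) :=
  \matrix_(a < k.+1, i < n) j a 0 i.

(* Differential functions over V: finite order, no restriction on the
   derivatives of u, smooth in all the variables they depend on. *)
Definition differential_fun (V : set 'rV[K]_n) (F : jet_fun) : Prop :=
  exists k : nat, exists2 f : 'M[K]_(k.+1, n) -> K,
    smooth_on [set x | V (row ord0 x)] f &
    forall j : jet, V (j 0%N) -> F j = f (jet_trunc k j).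

Definition jet_pderiv (F : jet_fun) (a : nat) (i : 'I_n) : jet_fun :=
  fun j => derive1
    (fun t : K => F (fun b => if b == a then j b + t *: delta_mx 0 i else j b)) 0.

(* D F = sum_(a, i) u^i_(a+1) dF/du^i_a.  The sum over a is the finitely
   supported one: for F of order k the terms with a > k vanish. *)
Definition total_deriv (F : jet_fun) : jet_fun :=
  fun j => \sum_(a \in [set: nat]) \sum_(i < n) jet_pderiv F a i j * j a.+1 0 i.

Definition is_total_deriv (V : set 'rV[K]_n) (E : jet_fun) : Prop :=
  exists2 F : jet_fun, differential_fun V F &
    forall j : jet, V (j 0%N) -> E j = total_deriv F j.

Definition grad (f : 'rV[K]_n -> K) (u : 'rV[K]_n) (i : 'I_n) : K :=
  'D_(delta_mx 0 i) f u.

(* A matrix differential operator, as its action P^{ij} psi_j on n-tuples. *)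
Definition matrix_op : Type := ('I_n -> jet_fun) -> ('I_n -> jet_fun).

(* d g^{ij} d, for a derivation d and the coefficients g^{ij} on jets. *)
Definition second_order_op (d : jet_fun -> jet_fun) (g : jet -> 'M[K]_n) :
    matrix_op :=
  fun psi i => d (fun j => \sum_(l < n) g j i l * d (psi l) j).

Definition skew3 (T : 'I_n -> 'I_n -> 'I_n -> K) : Prop :=
  forall i j k, T j i k = - T i j k /\ T i k j = - T i j k.

Definition skew2 (B : 'M[K]_n) : Prop := forall i j, B j i = - B i j.

(* G u is the matrix (g_{ij}(u)) with lower indices. *)
Definition canonical_metric (G : 'rV[K]_n -> 'M[K]_n) : Prop :=
  (exists (T : 'I_n -> 'I_n -> 'I_n -> K) (g0 : 'M[K]_n),
     [/\ skew3 T, skew2 g0 &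
         forall u i j, G u i j = \sum_(k < n) T i j k * u 0 k + g0 i j]) /\
  (exists u, \det (G u) != 0).

(* D_x g^{ij} D_x; meaningful over the set where \det (G u) != 0, since invmx
   is the identity on singular matrices. *)
Definition ham_op (G : 'rV[K]_n -> 'M[K]_n) : matrix_op :=
  second_order_op total_deriv (fun j => invmx (G (j 0%N))).

End Jets.

Section ProjectiveReciprocal.
Variables (K : numFieldType) (n : nat).
Variable a : 'M[K]_(n + 1).

(* The rows of a carry the upper index; [lshift 1 i] is the index i of 1..n
   and [rshift n ord0] is the index n+1. *)
Definition proj_num (i : 'I_n) (u : 'rV[K]_n) : K :=
  \sum_(j < n) a (lshift 1 i) (lshift 1 j) * u 0 j
    + a (lshift 1 i) (rshift n ord0).

Definition proj_den (u : 'rV[K]_n) : K :=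
  \sum_(j < n) a (rshift n ord0) (lshift 1 j) * u 0 j
    + a (rshift n ord0) (rshift n ord0).

Definition proj_map (u : 'rV[K]_n) : 'rV[K]_n :=
  \row_(i < n) (proj_num i u / proj_den u).

(* The total derivative with respect to the new independent variable, written
   on the jets in (x, u): D_x = A D_{x~}. *)
Definition total_deriv_new (F : jet_fun K n) : jet_fun K n :=
  fun j => (proj_den (j 0%N))^-1 * total_deriv F j.

(* D_{x~} g~^{kl} D_{x~}, with g~^{kl} evaluated at the new variables. *)
Definition ham_op_new (Gt : 'rV[K]_n -> 'M[K]_n) : matrix_op K n :=
  second_order_op total_deriv_new (fun j => invmx (Gt (proj_map (j 0%N)))).

(* f and ft are the old and new expressions of the same density on V.  As
   proj_map is injective where A != 0, this determines ft on the image of V. *)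
Definition density_pair (V : set 'rV[K]_n) (f ft : 'rV[K]_n -> K) : Prop :=
  forall u, V u -> f u = proj_den u * ft (proj_map u).

(* P is transformed into Pt on W.  Pt acts on functions of the new variables
   pulled back to the jets in (x, u).  Functions defined only on a smaller
   open set V are allowed. *)
Definition op_transformed (W : set 'rV[K]_n) (P Pt : matrix_op K n) : Prop :=
  forall (V : set 'rV[K]_n) (f h ft ht : 'rV[K]_n -> K),
    open V -> V `<=` W ->
    smooth_on V f -> smooth_on V h ->
    density_pair V f ft -> density_pair V h ht ->
    is_total_deriv V (fun j =>
      \sum_(i < n) grad f (j 0%N) i
         * P (fun l j' => grad h (j' 0%N) l) i j
      - proj_den (j 0%N) *
        \sum_(k < n) grad ft (proj_map (j 0%N)) k
         * Pt (fun l j' => grad ht (proj_map (j' 0%N)) l) k j).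

Definition regular_set (G : 'rV[K]_n -> 'M[K]_n) : set 'rV[K]_n :=
  [set u | proj_den u != 0 /\ \det (G u) != 0].

End ProjectiveReciprocal.

(* Main.v *)
(* Homogeneous coordinates [U = (u, 1)] in dimension n+1 turn the affine
   metric [g_ij(u)] into the contraction with [U] of a constant 3-form, and the
   projective map into the linear map [a]; the new metric is the contraction of
   the 3-form transported by [a].  As [A U~ = a U] and a 3-form vanishes on
   repeated arguments, [g = A M^T g~ M], where [M^k_i = a^k_i - a^(n+1)_i u~^k]
   is [A] times the Jacobian matrix.  The gradients of a density are related by
   [f_i = M^k_i f~_k + a^(n+1)_i f~], and differentiating along x kills the last
   term: [D_x f_i = M^k_i D_x f~_k].  With [W^i = g^il D_x h_l], the difference of
   the two sides is the total derivative of [(f / A) a^(n+1)_i W^i]. *)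
From HB Require Import structures.
Require Import Defs.
From mathcomp Require Import all_boot all_order all_algebra.
From mathcomp Require Import all_classical all_reals all_analysis.
From mathcomp Require Import ring.
Import Order.TTheory GRing.Theory Num.Theory.
Import numFieldNormedType.Exports.
Local Open Scope classical_set_scope.
Local Open Scope ring_scope.
Set Implicit Arguments.
Unset Strict Implicit.
Unset Printing Implicit Defensive.

(** * Locality of differentiability and closure properties of smooth functions *)

Lemma near_eq_differentiable (K : numFieldType) (U W : normedModType K)
    (f g : U -> W) (x : U) :
  (\near x, f x = g x) -> differentiable f x -> differentiable g x.
Proof.
(* The correction [g - f] vanishes near [x], so it is differentiable there with differential 0. *)
move=> fg df; have <- : f + (g - f) = g by rewrite addrC subrK.
apply: differentiableD => //.
have gf0 : (g - f) x = 0.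
  by rewrite -[LHS]/(g x - f x) (nbhs_singleton fg) subrr.
have e0 : (g - f) \o shift x = cst ((g - f) x) + 0 +o_ 0 id.
  apply/eqaddoP => _/posnumP[e]; rewrite gf0 addr0.
  move: fg; rewrite (near_shift 0) subr0 => fg; near=> y.
  have fgy : f (y + x) = g (y + x).
    exact: (near fg y).
  rewrite -[X in `|X|]/(g (y + x) - f (y + x) - 0) fgy subrr subr0 normr0.
  by rewrite mulr_ge0.
have d0 : 'd (g - f) x = 0 :> (U -> W).
  by apply/diff_unique => //; exact: cst_continuous.
by apply/diff_locallyP; split; rewrite d0 //; exact: cst_continuous.
Unshelve. all: by end_near. Qed.

Section SmoothAlgebra.
Variables (K : numFieldType) (m n : nat).
Implicit Types (V : set 'M[K]_(m, n)) (f g : 'M[K]_(m, n) -> K).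

(** Smoothness cut off at order [k], to allow induction on the order: one partial derivative lowers
    [k] by one, and the product and quotient rules involve only data of the lower order. *)
Definition smooth_upto V (k : nat) f : Prop :=
  forall s : seq ('I_m * 'I_n), (size s <= k)%N ->
    forall x, V x -> differentiable (foldl (@pderiv K m n) f s) x.

Lemma smooth_onP V f : smooth_on V f <-> forall k, smooth_upto V k f.
Proof.
split=> [fs k s _ x Vx|fs s x Vx]; first exact: fs.
exact: (fs (size s)).
Qed.

Lemma smooth_uptoS V k f : smooth_upto V k.+1 f <->
  (forall x, V x -> differentiable f x) /\
  (forall p, smooth_upto V k (pderiv f p)).
Proof.
split=> [fs|[f0 fs] [|p s] ss]; last by apply: fs.
  by split=> [x Vx|p s ss]; [exact: (fs [::])|exact: (fs (p :: s))].
by move=> x Vx; exact: f0.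
Qed.

Lemma smooth_uptoW V k f : smooth_upto V k.+1 f -> smooth_upto V k f.
Proof. by move=> fs s ss; apply: fs; exact: leqW. Qed.

Lemma smooth_upto_diff V k f x : smooth_upto V k f -> V x -> differentiable f x.
Proof. by move=> fs; exact: (fs [::]). Qed.

Lemma smooth_on_diff V f x : smooth_on V f -> V x -> differentiable f x.
Proof. by move=> fs; exact: (fs [::]). Qed.

Lemma smooth_on_pderiv V f p : smooth_on V f -> smooth_on V (pderiv f p).
Proof. by move=> fs s; exact: (fs (p :: s)). Qed.

(** On an open set, equality at a point is equality near it, so it is inherited by all partial
    derivatives. *)
Lemma smooth_upto_eq V k f g : open V -> {in V, f =1 g} ->
  smooth_upto V k f -> smooth_upto V k g.
Proof.
move=> oV; elim: k f g => [|k IH] f g fg.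
  move=> fs [|//] _ x Vx /=; apply: near_eq_differentiable (smooth_upto_diff fs Vx).
  by near=> y; apply: fg; rewrite inE; near: y; exact: open_nbhs_nbhs.
have nfg x : V x -> \near x, f x = g x.
  by move=> Vx; near=> y; apply: fg; rewrite inE; near: y; exact: open_nbhs_nbhs.
move=> /smooth_uptoS[f0 fs]; apply/smooth_uptoS; split=> [x Vx|p].
  exact: near_eq_differentiable (nfg x Vx) (f0 x Vx).
apply: IH (fs p) => x; rewrite inE => Vx.
exact/near_eq_derive/nfg.
Unshelve. all: by end_near. Qed.

Lemma smooth_on_eq V f g : open V -> {in V, f =1 g} ->
  smooth_on V f -> smooth_on V g.
Proof.
by move=> oV fg /smooth_onP fs; apply/smooth_onP => k; exact: smooth_upto_eq fg _.
Qed.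

Lemma smooth_on_cst V (c : K) : smooth_on V (fun=> c).
Proof.
apply/smooth_onP => k; elim: k c => [|k IH] c.
  by move=> [|//] _ x _; exact: differentiable_cst.
apply/smooth_uptoS; split=> [x _|p]; first exact: differentiable_cst.
have -> : pderiv (fun=> c) p = fun=> 0 :> K; last exact: IH.
by apply/funext => x; exact: derive_cst.
Qed.

Lemma smooth_uptoD V k f g : open V ->
  smooth_upto V k f -> smooth_upto V k g -> smooth_upto V k (fun x => f x + g x).
Proof.
move=> oV; elim: k f g => [|k IH] f g fs gs.
  move=> [|//] _ x Vx; exact: differentiableD (smooth_upto_diff fs Vx) (smooth_upto_diff gs Vx).
have [/smooth_uptoS[f0 f1] /smooth_uptoS[g0 g1]] := (fs, gs).
apply/smooth_uptoS; split=> [x Vx|p]; first exact: differentiableD (f0 x Vx) (g0 x Vx).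
apply: smooth_upto_eq (IH _ _ (f1 p) (g1 p)) => // x; rewrite inE => Vx.
by rewrite /pderiv -deriveD //; apply: diff_derivable; [exact: f0|exact: g0].
Qed.

Lemma smooth_uptoM V k f g : open V ->
  smooth_upto V k f -> smooth_upto V k g -> smooth_upto V k (fun x => f x * g x).
Proof.
move=> oV; elim: k f g => [|k IH] f g fs gs.
  move=> [|//] _ x Vx; exact: differentiableM (smooth_upto_diff fs Vx) (smooth_upto_diff gs Vx).
have [/smooth_uptoS[f0 f1] /smooth_uptoS[g0 g1]] := (fs, gs).
apply/smooth_uptoS; split=> [x Vx|p]; first exact: differentiableM (f0 x Vx) (g0 x Vx).
apply: smooth_upto_eq (smooth_uptoD oV (IH _ _ (smooth_uptoW fs) (g1 p))
  (IH _ _ (smooth_uptoW gs) (f1 p))) => // x; rewrite inE => Vx.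
by rewrite /pderiv -deriveM //; apply: diff_derivable; [exact: f0|exact: g0].
Qed.

Lemma smooth_onD V f g : open V ->
  smooth_on V f -> smooth_on V g -> smooth_on V (fun x => f x + g x).
Proof.
move=> oV /smooth_onP fs /smooth_onP gs; apply/smooth_onP => k.
exact: smooth_uptoD.
Qed.

Lemma smooth_onM V f g : open V ->
  smooth_on V f -> smooth_on V g -> smooth_on V (fun x => f x * g x).
Proof.
move=> oV /smooth_onP fs /smooth_onP gs; apply/smooth_onP => k.
exact: smooth_uptoM.
Qed.

(** The partial derivatives of [1/f] are [- (1/f)^2] times those of [f], so order [k] for [1/f]
    gives order [k] for its derivatives. *)
Lemma smooth_onV V f : open V -> (forall x, V x -> f x != 0) ->
  smooth_on V f -> smooth_on V (fun x => (f x)^-1).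
Proof.
move=> oV fN0 fs; have f0 x : V x -> differentiable f x by exact: smooth_on_diff.
have fV x : V x -> differentiable (fun x => (f x)^-1) x.
  by move=> Vx; exact: differentiableV (f0 x Vx) (fN0 x Vx).
apply/smooth_onP; elim=> [|k IH]; first by move=> [|//] _.
apply/smooth_uptoS; split=> // p.
have h2 := smooth_uptoM oV IH IH.
have h3 := smooth_uptoM oV ((smooth_onP _ _).1 (smooth_on_cst (- 1)) k) h2.
have h4 := smooth_uptoM oV h3
  ((smooth_onP _ _).1 (smooth_on_pderiv p fs) k).
apply: smooth_upto_eq h4 => // x; rewrite inE => Vx.
rewrite /pderiv (deriveV (fN0 x Vx) (diff_derivable (f0 x Vx))).
by rewrite mulN1r -expr2 -exprVn.
Qed.

Lemma smooth_on_sum V (I : Type) (r : seq I) (P : pred I)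
    (F : I -> 'M[K]_(m, n) -> K) : open V ->
  (forall i, P i -> smooth_on V (F i)) ->
  smooth_on V (fun x => \sum_(i <- r | P i) F i x).
Proof.
move=> oV Fs; elim: r => [|i r IH].
  by apply: (smooth_on_eq oV _ (smooth_on_cst 0)) => x _; rewrite big_nil.
case Pi: (P i).
  have := smooth_onD oV (Fs i Pi) IH.
  by apply: (smooth_on_eq oV) => x _; rewrite big_cons Pi.
by move: IH; apply: (smooth_on_eq oV) => x _; rewrite big_cons Pi.
Qed.

Lemma smooth_on_prod V (I : Type) (r : seq I) (P : pred I)
    (F : I -> 'M[K]_(m, n) -> K) : open V ->
  (forall i, P i -> smooth_on V (F i)) ->
  smooth_on V (fun x => \prod_(i <- r | P i) F i x).
Proof.
move=> oV Fs; elim: r => [|i r IH].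
  by apply: (smooth_on_eq oV _ (smooth_on_cst 1)) => x _; rewrite big_nil.
case Pi: (P i).
  have := smooth_onM oV (Fs i Pi) IH.
  by apply: (smooth_on_eq oV) => x _; rewrite big_cons Pi.
by move: IH; apply: (smooth_on_eq oV) => x _; rewrite big_cons Pi.
Qed.

Lemma derive_coord (i : 'I_m) (j : 'I_n) (x v : 'M[K]_(m, n)) :
  'D_v (fun x : 'M[K]_(m, n) => x i j) x = v i j.
Proof.
pose c := fun x : 'M[K]_(m, n) => x i j.
(* Packed as a continuous linear map, the coordinate is its own differential. *)
have cl : linear c by move=> k a b; rewrite /c !mxE.
pose cL := GRing.isLinear.Build _ _ _ _ c cl.
pose c' : {linear 'M[K]_(m, n) -> K} := HB.pack c cL.
rewrite deriveE; last exact: differentiable_coord.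
have := @diff_lin _ _ _ c' x (@coord_continuous K m n i j).
by move=> /(congr1 (fun f => f v)).
Qed.

Lemma smooth_on_coord V i j : smooth_on V (fun x => x i j).
Proof.
apply/smooth_onP; case=> [|k].
  by move=> [|//] _ x _; exact: differentiable_coord.
apply/smooth_uptoS; split=> [x _|p]; first exact: differentiable_coord.
have -> : pderiv (fun x => x i j) p = fun=> (delta_mx p.1 p.2 : 'M[K]_(m, n)) i j.
  by apply/funext => x; exact: derive_coord.
exact: (smooth_onP _ _).1 (smooth_on_cst _) k.
Qed.

Lemma smooth_on_det V p (M : 'M[K]_(m, n) -> 'M[K]_p) : open V ->
  (forall i j, smooth_on V (fun x => M x i j)) -> smooth_on V (fun x => \det (M x)).
Proof.
move=> oV Ms; rewrite /determinant; apply: smooth_on_sum => // s _.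
by apply: smooth_onM => //; [exact: smooth_on_cst|exact: smooth_on_prod].
Qed.

(** Cramer's rule: where the determinant does not vanish, the entries of the inverse are cofactors
    divided by it. *)
Lemma smooth_on_invmx V p (M : 'M[K]_(m, n) -> 'M[K]_p) i j : open V ->
  (forall x, V x -> \det (M x) != 0) ->
  (forall i j, smooth_on V (fun x => M x i j)) ->
  smooth_on V (fun x => invmx (M x) i j).
Proof.
move=> oV MN0 Ms.
have h : smooth_on V (fun x => (\det (M x))^-1 * cofactor (M x) j i).
  apply: smooth_onM => //.
    by apply: smooth_onV => //; exact: smooth_on_det.
  apply: smooth_onM => //; first exact: smooth_on_cst.
  apply: smooth_on_det => // k l.
  by apply: (smooth_on_eq oV _ (Ms _ _)) => x _; rewrite !mxE.
apply: smooth_on_eq h => // x; rewrite inE => Vx.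
by rewrite /invmx unitmxE unitfE MN0 // !mxE.
Qed.

End SmoothAlgebra.

(** * Functions of one row, seen as functions on truncated jets *)

Section RowPullback.
Variables (K : numFieldType) (m n : nat) (i0 : 'I_m).

Lemma row_continuous : continuous (row i0 : 'M[K]_(m, n) -> 'rV[K]_n).
Proof.
move=> M s /= /(nbhs_ballP (row i0 M)) [e e0 es].
apply/nbhs_ballP; exists e => //= N [_ MN]; apply: es; split=> // i j.
by rewrite !mxE; exact: MN.
Qed.

Lemma open_row_preimage (V : set 'rV[K]_n) :
  open V -> open [set x : 'M[K]_(m, n) | V (row i0 x)].
Proof. by move=> oV; apply: (open_comp _ oV) => x _; exact: row_continuous. Qed.

Lemma differentiable_row (x : 'M[K]_(m, n)) : differentiable (row i0) x.
Proof. exact/linear_differentiable/row_continuous. Qed.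

Lemma derive_comp_row (f : 'rV[K]_n -> K) (x v : 'M[K]_(m, n)) :
  differentiable f (row i0 x) -> 'D_v (f \o row i0) x = 'D_(row i0 v) f (row i0 x).
Proof.
move=> df; have dr := differentiable_row x.
rewrite deriveE; last exact: differentiable_comp.
rewrite (diff_comp dr df) /= deriveE //.
by rewrite (diff_lin _ (@row_continuous)).
Qed.

(** By the chain rule, the partial derivative in entry [p] is that of [f] in direction [p.2] if
    [p.1] is the chosen row and 0 otherwise; the factor [(p.1 == i0)%:R] covers both cases. *)
Lemma smooth_on_comp_row (V : set 'rV[K]_n) (f : 'rV[K]_n -> K) :
  open V -> smooth_on V f -> smooth_on [set x | V (row i0 x)] (fun x => f (row i0 x)).
Proof.
move=> oV fs; have dr := differentiable_row; have oW := open_row_preimage oV.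
apply/smooth_onP => k; elim: k f fs => [|k IH] f fs.
  move=> [|//] _ x Vx.
  by apply: differentiable_comp => //; exact: smooth_on_diff fs Vx.
apply/smooth_uptoS; split=> [x Vx|p].
  by apply: differentiable_comp => //; exact: smooth_on_diff fs Vx.
have h := smooth_uptoM oW
  ((smooth_onP _ _).1 (smooth_on_cst (p.1 == i0)%:R) k)
  (IH _ (smooth_on_pderiv (ord0, p.2) fs)).
apply: smooth_upto_eq h => // x; rewrite inE /= => Vx.
rewrite /pderiv [RHS]derive_comp_row; last exact: smooth_on_diff fs Vx.
have -> : row i0 (delta_mx p.1 p.2 : 'M[K]_(m, n)) = (p.1 == i0)%:R *: delta_mx 0 p.2.
  apply/rowP => j; rewrite !mxE eqxx /= eq_sym.
  by case: (_ == i0); rewrite ?mul1r ?mul0r.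
have df := smooth_on_diff fs Vx.
by rewrite !deriveE // linearZ.
Qed.

End RowPullback.

(** * Directional derivatives of finite sums, and the gradient *)

Section DirectionalDerivatives.
Variables (K : numFieldType) (U : normedModType K).
Implicit Types (x v : U).

Lemma derive_bigsum (p : nat) (F : 'I_p -> U -> K) x v :
  (forall i, derivable (F i) x v) ->
  'D_v (fun y => \sum_(i < p) F i y) x = \sum_(i < p) 'D_v (F i) x.
Proof.
move=> dF; rewrite -derive_sum //; congr (derive _ _ _).
by apply/funext => y; rewrite fct_sumE.
Qed.

Lemma derivable_bigsum (p : nat) (F : 'I_p -> U -> K) x v :
  (forall i, derivable (F i) x v) -> derivable (fun y => \sum_(i < p) F i y) x v.
Proof.
move=> dF; have -> : (fun y => \sum_(i < p) F i y) = \sum_(i < p) F i.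
  by apply/funext => y; rewrite fct_sumE.
exact: derivable_sum.
Qed.

Lemma derive_bigsumM (p : nat) (phi F : 'I_p -> U -> K) x v :
  (forall i, derivable (phi i) x v) -> (forall i, derivable (F i) x v) ->
  'D_v (fun y => \sum_(i < p) phi i y * F i y) x =
  \sum_(i < p) ('D_v (phi i) x * F i x + phi i x * 'D_v (F i) x).
Proof.
move=> dphi dF; rewrite derive_bigsum => [|i]; last exact: derivableM.
by apply: eq_bigr => i _; rewrite [LHS]deriveM // addrC mulrC.
Qed.

Lemma derivableMr (f : U -> K) (c : K) x v :
  derivable f x v -> derivable (fun y => f y * c) x v.
Proof. by move=> df; apply: derivableM => //; exact: derivable_cst. Qed.

End DirectionalDerivatives.

Lemma derive_grad (K : numFieldType) (n : nat) (f : 'rV[K]_n -> K) (x v : 'rV[K]_n) :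
  differentiable f x -> 'D_v f x = \sum_(i < n) grad f x i * v 0 i.
Proof.
move=> df; rewrite deriveE // {1}[v]row_sum_delta linear_sum.
by apply: eq_bigr => i _; rewrite linearZ /grad deriveE // mulrC.
Qed.

(** * The total derivative on functions of order at most one *)

Section TotalDerivative.
Variables (K : numFieldType) (n : nat).
Implicit Types (V : set 'rV[K]_n) (F : jet_fun K n) (j : jet K n).

(** The set [V] constrains only [j 0]. Varying a higher derivative leaves [j 0] fixed, and a small
    variation of [j 0] stays in the open set [V], so each partial derivative sees only jets on which
    the functions agree. *)
Lemma eq_total_deriv V F1 F2 j : open V -> V (j 0%N) ->
  (forall j', V (j' 0%N) -> F1 j' = F2 j') -> total_deriv F1 j = total_deriv F2 j.
Proof.
move=> oV Vj F12; rewrite /total_deriv; apply: eq_fsbigr => a _.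
apply: eq_bigr => i _; congr (_ * _); rewrite /jet_pderiv !derive1E.
apply: near_eq_derive.
have cg : {for 0, continuous (fun t : K => j 0%N + t *: (delta_mx 0 i : 'rV[K]_n))}.
  apply: continuousD; first exact: cst_continuous.
  by apply: continuousZr_tmp; exact: cvg_id.
have Vg : \forall t \near (0 : K), V (j 0%N + t *: (delta_mx 0 i : 'rV[K]_n)).
  by apply: cg; rewrite scale0r addr0; exact: open_nbhs_nbhs.
near=> t; apply: F12; case: (0 == a)%N => //.
by near: t.
Unshelve. all: by end_near. Qed.

(** A function that depends only on the derivatives of order below [k] is constant along variations
    of the others, whose terms therefore vanish. *)
Lemma total_deriv_finite (k : nat) F j :
  (forall j1 j2 : jet K n, (forall b, (b < k)%N -> j1 b = j2 b) -> F j1 = F j2) ->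
  total_deriv F j = \sum_(a < k) \sum_(i < n) jet_pderiv F a i j * j a.+1 0 i.
Proof.
move=> kF; rewrite /total_deriv.
rewrite (@fsbig_ord _ _ _ k (fun a => \sum_(i < n) jet_pderiv F a i j * j a.+1 0 i)).
symmetry; apply: fsbig_widen => // a [_ /negP]; rewrite -leqNgt => ka /=.
apply: big1 => i _; rewrite /jet_pderiv derive1E.
rewrite (_ : (fun t => _) = cst (F j)) ?derive_cst ?mul0r //.
apply/funext => t; apply: kF => b bk.
by case: eqP => // ba; move: bk; rewrite ba ltnNge ka.
Qed.

Lemma derive1_line (phi : 'rV[K]_n -> K) (x v : 'rV[K]_n) :
  derive1 (fun t : K => phi (x + t *: v)) 0 = 'D_v phi x.
Proof.
rewrite /derive1 /derive; set f1 := (X in lim (X @ _)).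
set f2 := (X in _ = lim (X @ _)); suff -> : f1 = f2 by [].
by apply/funext => h; rewrite /f1 /f2 /= addr0 scale0r addr0 [x + _]addrC.
Qed.

Lemma total_deriv_point (phi : 'rV[K]_n -> K) j : differentiable phi (j 0%N) ->
  total_deriv (fun j' => phi (j' 0%N)) j = 'D_(j 1%N) phi (j 0%N).
Proof.
move=> dphi; rewrite (@total_deriv_finite 1) => [|j1 j2 -> //].
rewrite big_ord1 derive_grad //; apply: eq_bigr => i _; congr (_ * _).
by rewrite /jet_pderiv /= derive1_line.
Qed.

(** The shape of [g^{il} D_x h_l], of its images under the Jacobian and of the potential, so that
    one formula for the total derivative serves them all. *)
Definition linear_in_velocity (c : 'I_n -> 'rV[K]_n -> K) : jet_fun K n :=
  fun j => \sum_(m < n) c m (j 0%N) * j 1%N 0 m.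

(** The variation of [j 0] differentiates the coefficients along [u_x], with the factor [u_x]
    frozen; the variation of [j 1] gives the term in [u_xx]. *)
Lemma total_deriv_velocity (c : 'I_n -> 'rV[K]_n -> K) j :
  (forall m, differentiable (c m) (j 0%N)) ->
  total_deriv (linear_in_velocity c) j =
  'D_(j 1%N) (fun u => \sum_(m < n) c m u * j 1%N 0 m) (j 0%N)
  + \sum_(m < n) c m (j 0%N) * j 2%N 0 m.
Proof.
move=> dc; rewrite (@total_deriv_finite 2); last first.
  by move=> j1 j2 j12; rewrite /linear_in_velocity !j12.
rewrite big_ord_recl big_ord1 /= /bump /= addn0; congr (_ + _).
  rewrite derive_grad; last first.
    have -> : (fun u => \sum_(m < n) c m u * j 1%N 0 m) =
              \sum_(m < n) (fun u => c m u * j 1%N 0 m).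
      by apply/funext => y; rewrite fct_sumE.
    apply: differentiable_sum => m.
    by apply: differentiableM => //; exact: differentiable_cst.
  apply: eq_bigr => i _; congr (_ * _).
  rewrite /jet_pderiv /linear_in_velocity /=.
  by rewrite (derive1_line (fun u => \sum_(m < n) c m u * j 1%N 0 m)).
apply: eq_bigr => i _; congr (_ * _).
rewrite /jet_pderiv /linear_in_velocity /=.
rewrite (derive1_line (fun w => \sum_(m < n) c m (j 0%N) * w 0 m)).
rewrite derive_bigsumM => [|m|m]; last 2 first.
- exact: derivable_cst.
- exact/diff_derivable/differentiable_coord.
rewrite (bigD1 i) //= big1 => [|m mi].
  by rewrite derive_cst mul0r add0r derive_coord mxE !eqxx mulr1 addr0.
by rewrite derive_cst mul0r add0r derive_coord mxE (negPf mi) andbF mulr0.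
Qed.

(** The Leibniz rule. The factors [phi i] are absorbed into the coefficients, so that the sum is
    again linear in the velocity. *)
Lemma total_deriv_velocityM (p : nat) (phi : 'I_p -> 'rV[K]_n -> K)
    (c : 'I_p -> 'I_n -> 'rV[K]_n -> K) j :
  (forall i, differentiable (phi i) (j 0%N)) ->
  (forall i m, differentiable (c i m) (j 0%N)) ->
  total_deriv (fun j' => \sum_(i < p) phi i (j' 0%N) * linear_in_velocity (c i) j') j =
  \sum_(i < p) ('D_(j 1%N) (phi i) (j 0%N) * linear_in_velocity (c i) j
                + phi i (j 0%N) * total_deriv (linear_in_velocity (c i)) j).
Proof.
move=> dphi dc.
have -> : (fun j' : jet K n => \sum_(i < p) phi i (j' 0%N) * linear_in_velocity (c i) j') =
   linear_in_velocity (fun m u => \sum_(i < p) phi i u * c i m u).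
  apply/funext => j'; rewrite /linear_in_velocity.
  under [RHS]eq_bigr do rewrite mulr_suml.
  rewrite exchange_big; apply: eq_bigr => i _; rewrite mulr_sumr.
  by apply: eq_bigr => m _; rewrite mulrA.
rewrite total_deriv_velocity; last first.
  move=> m; have -> : (fun u => \sum_(i < p) phi i u * c i m u) =
              \sum_(i < p) (fun u => phi i u * c i m u).
    by apply/funext => y; rewrite fct_sumE.
  by apply: differentiable_sum => i; exact: differentiableM.
have -> : (fun u => \sum_(m < n) (\sum_(i < p) phi i u * c i m u) * j 1%N 0 m) =
    (fun u => \sum_(i < p) phi i u * \sum_(m < n) c i m u * j 1%N 0 m).
  apply/funext => u; under eq_bigr do rewrite mulr_suml.
  rewrite exchange_big; apply: eq_bigr => i _; rewrite mulr_sumr.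
  by apply: eq_bigr => m _; rewrite mulrA.
rewrite derive_bigsumM; last 2 first.
- by move=> i; exact: diff_derivable.
- move=> i; apply: derivable_bigsum => m; apply: derivableMr.
  exact: diff_derivable.
have -> : \sum_(m < n) (\sum_(i < p) phi i (j 0%N) * c i m (j 0%N)) * j 2%N 0 m =
   \sum_(i < p) phi i (j 0%N) * \sum_(m < n) c i m (j 0%N) * j 2%N 0 m.
  under eq_bigr do rewrite mulr_suml.
  rewrite exchange_big; apply: eq_bigr => i _; rewrite mulr_sumr.
  by apply: eq_bigr => m _; rewrite mulrA.
rewrite -big_split; apply: eq_bigr => i _ /=.
by rewrite total_deriv_velocity // mulrDr addrA.
Qed.

End TotalDerivative.

(** * Constant 3-forms, their contractions and pullbacks *)

Section Trivectors.
Variables (K : numFieldType) (p : nat).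
Implicit Types (Om : 'I_p -> 'I_p -> 'I_p -> K) (w : 'cV[K]_p) (b : 'M[K]_p).

Definition contract Om w : 'M[K]_p := \matrix_(i, j) \sum_k Om i j k * w k 0.

(** The form [Om(b x, b y, b z)]. It is applied with [b] the inverse of [a], which transports [Om]
    along [a]. *)
Definition pullback b Om (i j k : 'I_p) : K :=
  \sum_l \sum_m \sum_r Om l m r * (b l i * b m j * b r k).

Lemma skew3_pullback b Om : skew3 Om -> skew3 (pullback b Om).
Proof.
move=> sk i j k; split; rewrite /pullback -sumrN.
  rewrite exchange_big; apply: eq_bigr => l _; rewrite -sumrN.
  apply: eq_bigr => m _; rewrite -sumrN; apply: eq_bigr => r _.
  by rewrite (sk l m r).1 mulNr [b m j * _]mulrC.
apply: eq_bigr => l _; rewrite -sumrN exchange_big.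
apply: eq_bigr => m _; rewrite -sumrN; apply: eq_bigr => r _.
by rewrite (sk l m r).2 mulNr mulrAC.
Qed.

Lemma contract_pullback b Om w :
  contract (pullback b Om) w = b^T *m contract Om (b *m w) *m b.
Proof.
apply/matrixP => i j; rewrite !mxE /pullback.
under eq_bigr do rewrite mulr_suml.
rewrite exchange_big /=.
under eq_bigr => l _.
  under eq_bigr do rewrite mulr_suml.
  rewrite exchange_big /=.
  under eq_bigr => m _.
    under eq_bigr do rewrite mulr_suml.
    rewrite exchange_big /=.
    over.
  over.
rewrite exchange_big /=; apply: eq_bigr => m _.
rewrite mxE mulr_suml; apply: eq_bigr => l _.
rewrite !mxE mulr_sumr mulr_suml; apply: eq_bigr => r _.
rewrite mxE !mulr_sumr mulr_suml; apply: eq_bigr => k _.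
by ring.
Qed.

Lemma contractZ Om (c : K) w : contract Om (c *: w) = c *: contract Om w.
Proof.
apply/matrixP => i j; rewrite !mxE mulr_sumr; apply: eq_bigr => k _.
by rewrite mxE mulrCA.
Qed.

Lemma trmx_contract Om w : skew3 Om -> (contract Om w)^T = - contract Om w.
Proof.
move=> sk; apply/matrixP => i j; rewrite !mxE -sumrN.
by apply: eq_bigr => k _; rewrite (sk i j k).1 mulNr.
Qed.

Lemma contract_self Om w : skew3 Om -> contract Om w *m w = 0.
Proof.
move=> sk; apply/matrixP => i j; rewrite ord1 [RHS]mxE; apply/eqP.
(* Exchanging the two summation indices in one copy turns it into the negative of the other; the
   characteristic is 0. *)
suff : (contract Om w *m w) i 0 *+ 2 == 0 by rewrite mulrn_eq0.
rewrite mulr2n mxE.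
under eq_bigr do rewrite mxE mulr_suml.
rewrite {1}exchange_big -big_split big1 //= => k _.
rewrite -big_split big1 //= => l _.
by rewrite (sk i k l).2; ring.
Qed.

End Trivectors.

(** * Homogeneous coordinates and the transformation of the metric *)

Section Homogenization.
Variables (K : numFieldType) (n : nat).
Implicit Types (u v : 'rV[K]_n) (a b : 'M[K]_(n + 1)).

Definition homog u : 'cV[K]_(n + 1) := col_mx u^T 1%:M.

(** In form notation [T + g0 ^ e^(n+1)]: components with a single index [n+1] are those of [g0],
    with the sign that skew-symmetry forces, and those with more than one vanish. *)
Definition homog_form (T : 'I_n -> 'I_n -> 'I_n -> K) (g0 : 'M[K]_n)
    (i j k : 'I_(n + 1)) : K :=
  match fintype.split i, fintype.split j, fintype.split k with
  | inl i, inl j, inl k => T i j k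
  | inl i, inl j, inr _ => g0 i j
  | inl i, inr _, inl k => - g0 i k
  | inr _, inl j, inl k => g0 j k
  | _, _, _ => 0
  end.

Lemma skew3_homog_form T g0 : skew3 T -> skew2 g0 -> skew3 (homog_form T g0).
Proof.
move=> sT sg i j k; rewrite /homog_form.
case: (fintype.split i) => i'; case: (fintype.split j) => j'; case: (fintype.split k) => k';
  by rewrite ?opprK ?oppr0.
Qed.

Definition metric_of (Om : 'I_(n + 1) -> 'I_(n + 1) -> 'I_(n + 1) -> K) u : 'M[K]_n :=
  ulsubmx (contract Om (homog u)).

Lemma metric_ofE Om u i j : metric_of Om u i j =
  \sum_(k < n) Om (lshift 1 i) (lshift 1 j) (lshift 1 k) * u 0 k
  + Om (lshift 1 i) (lshift 1 j) (rshift n ord0).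
Proof.
rewrite !mxE big_split_ord /= big_ord1 col_mxEd mxE eqxx mulr1; congr (_ + _).
by apply: eq_bigr => k _; rewrite col_mxEu mxE.
Qed.

Lemma metric_of_homog_form T g0 u i j :
  metric_of (homog_form T g0) u i j = \sum_(k < n) T i j k * u 0 k + g0 i j.
Proof.
have sl (k : 'I_n) : fintype.split (lshift 1 k) = inl k by exact: (unsplitK (inl k)).
have sr : fintype.split (rshift n ord0) = inr ord0 :> 'I_n + 'I_1 by exact: (unsplitK (inr ord0)).
rewrite metric_ofE /homog_form !sl sr; congr (_ + _).
by apply: eq_bigr => k _; rewrite sl.
Qed.

(** Converse of the homogenization: [T] and [g0] are read off as the components of [Om] without the
    index [n+1] and with it in the last place. *)
Lemma canonical_metric_of Om : skew3 Om ->
  (exists u, \det (metric_of Om u) != 0) -> canonical_metric (metric_of Om).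
Proof.
move=> sk hu; split=> //.
exists (fun i j k => Om (lshift 1 i) (lshift 1 j) (lshift 1 k)).
exists (\matrix_(i, j) Om (lshift 1 i) (lshift 1 j) (rshift n ord0)); split.
- by move=> i j k; split; [exact: (sk _ _ _).1|exact: (sk _ _ _).2].
- by move=> i j; rewrite !mxE; exact: (sk _ _ _).1.
- by move=> u i j; rewrite metric_ofE mxE.
Qed.

(** The first [n] entries of [a U] are the numerators and the last one is the common denominator. *)
Lemma mulmx_homog a u : proj_den a u != 0 ->
  a *m homog u = proj_den a u *: homog (proj_map a u).
Proof.
move=> A0.
have numE i : (a *m homog u) i 0 =
    \sum_(j < n) a i (lshift 1 j) * u 0 j + a i (rshift n ord0).
  rewrite mxE big_split_ord /= big_ord1 col_mxEd mxE eqxx mulr1; congr (_ + _).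
  by apply: eq_bigr => j _; rewrite col_mxEu mxE.
apply/colP => i; rewrite numE mxE -(splitK i); case: (fintype.split i) => [k|k] /=.
  by rewrite col_mxEu !mxE mulrCA divff // mulr1.
by rewrite ord1 col_mxEd mxE eqxx mulr1.
Qed.

(** The last entry of [homog u] is 1, so the scalar appears as the last entry of the product. *)
Lemma homog_inj_den a v (c : K) u : a *m homog v = c *: homog u -> proj_den a v = c.
Proof.
move=> e; have -> : c = (a *m homog v) (rshift n ord0) 0.
  by rewrite e mxE col_mxEd mxE eqxx mulr1.
rewrite mxE big_split_ord /= big_ord1 col_mxEd mxE eqxx mulr1; congr (_ + _).
by apply: eq_bigr => j _; rewrite col_mxEu mxE.
Qed.

Lemma homog_inj : injective homog.
Proof. by move=> u v /eq_col_mx[/trmx_inj]. Qed.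

Section Inverse.
Variables (a b : 'M[K]_(n + 1)) (u : 'rV[K]_n).
Hypothesis ba : b *m a = 1%:M.
Hypothesis A0 : proj_den a u != 0.
Let A := proj_den a u.
Let ut := proj_map a u.

Lemma mulmx_homog_proj : b *m homog ut = A^-1 *: homog u.
Proof.
apply: (scalerI A0); rewrite scalerA divff // scale1r scalemxAr -mulmx_homog //.
by rewrite mulmxA ba mul1mx.
Qed.

Lemma proj_den_inv : proj_den b ut = A^-1.
Proof. exact: homog_inj_den mulmx_homog_proj. Qed.

End Inverse.

(* [proj_jac a (proj_map a u)] is [proj_den a u] times the Jacobian of
   [proj_map a] at [u]. *)
Definition proj_jac a (w : 'rV[K]_n) : 'M[K]_n := ulsubmx a - w^T *m dlsubmx a.

(** Subtracting multiples of [homog w] from the first [n] columns of [a] clears their last entries.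
    Contractions with [homog w] do not see the change. *)
Lemma col_proj_jac a w : lsubmx a - homog w *m dlsubmx a = col_mx (proj_jac a w) 0.
Proof.
rewrite /homog mul_col_mx mul1mx -[lsubmx a]vsubmxK opp_col_mx add_col_mx.
have -> : usubmx (lsubmx a) = ulsubmx a by apply/matrixP => i j; rewrite !mxE.
have -> : dsubmx (lsubmx a) = dlsubmx a by apply/matrixP => i j; rewrite !mxE.
by rewrite subrr.
Qed.

Section Jacobian.
Variables (a b : 'M[K]_(n + 1)) (u : 'rV[K]_n).
Hypothesis ba : b *m a = 1%:M.
Hypothesis A0 : proj_den a u != 0.
Let A := proj_den a u.
Let ut := proj_map a u.

(** Follows from [b a = 1] and [b U~ = A^-1 U]. Its upper and lower blocks give the next two
    identities. *)
Lemma mulmx_col_proj_jac :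
  b *m col_mx (proj_jac a ut) 0 =
  col_mx (1%:M - A^-1 *: (u^T *m dlsubmx a)) (- (A^-1 *: dlsubmx a)).
Proof.
rewrite -col_proj_jac mulmxBr mulmxA (mulmx_homog_proj ba) //.
have -> : b *m lsubmx a = col_mx 1%:M 0.
  have -> : b *m lsubmx a = lsubmx (b *m a).
    by apply/matrixP => i j; rewrite !mxE; apply: eq_bigr => k _; rewrite mxE.
  by rewrite ba scalar_mx_block block_mxEh row_mxKl.
rewrite -scalemxAl /homog mul_col_mx mul1mx scale_col_mx opp_col_mx add_col_mx.
by rewrite add0r.
Qed.

(** The two factors are [A^-1] and [A] times mutually inverse Jacobians; in the block computation
    the rank-one terms cancel. *)
Lemma mul_proj_jac : proj_jac b u *m proj_jac a ut = 1%:M.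
Proof.
have := mulmx_col_proj_jac; rewrite -{1}[b]submxK mul_block_col !mulmx0 !addr0.
move=> /eq_col_mx[ue de]; rewrite /proj_jac mulmxBl -/(proj_jac _ _) ue -mulmxA de.
by rewrite mulmxN -scalemxAr opprK subrK.
Qed.

Lemma mul_dlsub_proj_jac : dlsubmx b *m proj_jac a ut = - (A^-1 *: dlsubmx a).
Proof.
have := mulmx_col_proj_jac; rewrite -{1}[b]submxK mul_block_col !mulmx0 !addr0.
by move=> /eq_col_mx[].
Qed.

Lemma metric_of_pullback Om : skew3 Om ->
  metric_of Om u =
  A *: ((proj_jac a ut)^T *m metric_of (pullback b Om) ut *m proj_jac a ut).
Proof.
move=> sk; set S := contract (pullback b Om) (homog ut).
have skS : S^T = - S by apply: trmx_contract; exact: skew3_pullback.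
(* Since [S] annihilates [homog ut] on both sides, the rank-one correction in [col_proj_jac] drops
   out and [lsubmx a] can replace the Jacobian column. *)
have S0 : S *m homog ut = 0 by apply: contract_self; exact: skew3_pullback.
have S0' : (homog ut)^T *m S = 0.
  by rewrite -[S]trmxK -trmx_mul skS mulNmx S0 oppr0 trmx0.
have -> : (proj_jac a ut)^T *m metric_of (pullback b Om) ut *m proj_jac a ut =
    (col_mx (proj_jac a ut) 0)^T *m S *m col_mx (proj_jac a ut) 0.
  rewrite -[S]submxK tr_col_mx trmx0 mul_row_block mul0mx addr0 mul_row_col.
  by rewrite !mulmx0 addr0.
rewrite -col_proj_jac mulmxBr -(mulmxA _ S (homog _ *m _)) (mulmxA S) S0 mul0mx.
rewrite mulmx0 subr0 linearB /= trmx_mul mulmxBl -(mulmxA _ _ S) S0' mulmx0 subr0.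
have -> : (lsubmx a)^T *m S *m lsubmx a = ulsubmx (a^T *m S *m a).
  rewrite -{3 4}[a]hsubmxK tr_row_mx mul_col_mx mul_col_row.
  by rewrite block_mxKul.
(* Conjugation by [a] undoes the pullback by [b]. What remains is the contraction with
   [b U~ = A^-1 U], whose scalar cancels the factor [A]. *)
rewrite /S contract_pullback (mulmx_homog_proj ba) // contractZ.
rewrite !mulmxA -trmx_mul ba trmx1 mul1mx -mulmxA ba mulmx1.
by rewrite /metric_of; apply/matrixP => i j; rewrite !mxE mulrA divff // mul1r.
Qed.

Lemma det_metric_of_pullback Om : skew3 Om ->
  \det (metric_of Om u) != 0 -> \det (metric_of (pullback b Om) ut) != 0.
Proof.
move=> sk; apply: contra_neq => det0.
by rewrite metric_of_pullback // detZ !det_mulmx det0 mulr0 mul0r mulr0.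
Qed.

(** The inverse of [g = A M^T g~ M], arranged for use in the operator: the transpose of
    [M^-1 = proj_jac b u] is what carries [D_x h_i] to [D_x h~_l]. *)
Lemma inv_metric_of_pullback Om : skew3 Om -> \det (metric_of Om u) != 0 ->
  invmx (metric_of (pullback b Om) ut) *m (proj_jac b u)^T =
  A *: (proj_jac a ut *m invmx (metric_of Om u)).
Proof.
move=> sk det0; have det1 := det_metric_of_pullback sk det0.
have Gu : metric_of Om u \in unitmx by rewrite unitmxE unitfE.
have Gtu : metric_of (pullback b Om) ut \in unitmx by rewrite unitmxE unitfE.
apply: (can_inj (mulKmx Gtu)); rewrite mulKVmx //.
apply: (can_inj (mulmxK Gu)); rewrite -scalemxAr -!scalemxAl.
rewrite (mulmxA _ (proj_jac a ut)) mulmxKV // metric_of_pullback // -scalemxAr.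
by rewrite !mulmxA -trmx_mul (mulmx1C mul_proj_jac) trmx1 mul1mx.
Qed.

End Jacobian.
End Homogenization.

(** * One-variable derivatives along a reparametrized line *)

Lemma is_derive_affine (K : numFieldType) (B beta t : K) :
  is_derive t 1 (fun t : K => B + t * beta) beta.
Proof.
have c1 := @derivable_cst K K K B t 1.
have c2 := @derivable_cst K K K beta t 1.
have i := @derivable_id K K t 1.
have m := derivableM i c2.
have d := derivableD c1 m.
split; first exact: d.
rewrite [LHS](deriveD c1 m) derive_cst add0r [LHS](deriveM i c2).
by rewrite derive_cst derive_id scaler0 add0r; exact: mulr1.
Qed.

Lemma is_derive_homography (K : numFieldType) (B beta : K) : B != 0 ->
  is_derive (0 : K) 1 (fun t : K => t * (B + t * beta)^-1) B^-1.
Proof.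
move=> B0; have [dl1 dl2] := is_derive_affine B beta 0.
have i := @derivable_id K K 0 1.
have l0 : B + 0 * beta != 0 by rewrite mul0r addr0.
have dV := @derivableV K K (fun t : K => B + t * beta) 0 1 l0 dl1.
split; first exact: derivableM i dV.
rewrite [LHS](deriveM i dV) derive_id scale0r add0r mul0r addr0; exact: mulr1.
Qed.

(** The map factors through the one-variable function [phi h = f (h *: w + u)], to which the chain
    rule applies. *)
Lemma is_derive_comp_line (K : numFieldType) (U : normedModType K) (f : U -> K)
    (u w : U) (s : K -> K) (d : K) :
  differentiable f u -> s 0 = 0 -> is_derive (0 : K) 1 s d ->
  is_derive (0 : K) 1 (fun t => f (s t *: w + u)) (d * 'D_w f u).
Proof.
move=> df s0 [ds dsE]; set phi := fun h : K => f (h *: w + u).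
have dphi : derivable phi 0 1.
have h := diff_derivable (v:=w) df. by move: h => /derivable1P.
have Dphi : 'D_1 phi 0 = 'D_w f u.
  rewrite -derive1E /derive1 /derive; set f1 := (X in lim (X @ _)).
  set f2 := (X in _ = lim (X @ _)); suff -> : f1 = f2 by [].
  by apply/funext => h; rewrite /f1 /f2 /phi /= addr0 scale0r add0r.
have sdiff : differentiable s 0 := (derivable1_diffP s 0).1 ds.
have pdiff : differentiable phi (s 0).
  by rewrite s0; exact: (derivable1_diffP phi 0).1.
have cdiff : differentiable (phi \o s) 0 := differentiable_comp sdiff pdiff.
split; first exact: ((derivable1_diffP (phi \o s) 0).2 cdiff).
have e1 := deriveE (1 : K) cdiff.
have e2 := congr1 (fun g => g (1 : K)) (diff_comp sdiff pdiff).
have e3 : 'd s 0 1 = d *: (1 : K).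
  by rewrite -(deriveE (1 : K) sdiff) dsE /GRing.scale /= mulr1.
have e5 : 'd phi (s 0) (1 : K) = 'D_w f u by rewrite -(deriveE (1 : K) pdiff) s0.
have e4 : 'd phi (s 0) (d *: (1 : K)) = d * 'D_w f u by rewrite linearZ e5.
apply: (etrans e1); apply: (etrans e2).
apply: (etrans (congr1 (fun y => 'd phi (s 0) y) e3)); exact: e4.
Qed.

(** * The gradient of a transformed density *)

Section DensityGradient.
Variables (K : numFieldType) (n : nat) (a b : 'M[K]_(n + 1)).
Hypotheses (ba : b *m a = 1%:M) (ab : a *m b = 1%:M).
Variables (V : set 'rV[K]_n) (f ft : 'rV[K]_n -> K) (u : 'rV[K]_n).
Hypotheses (oV : open V) (Vu : V u) (A0 : proj_den a u != 0).
Hypotheses (df : differentiable f u) (fft : density_pair a V f ft).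

(** No regularity of [ft] is assumed: near [t = 0] the density relation gives
    [ft (v + t *: e) = l t * f (c t)], with [l] the denominator of the inverse map along the line,
    and the right side is differentiable at 0. *)
Lemma grad_density k : grad ft (proj_map a u) k =
  \sum_(i < n) grad f u i * proj_jac b u i k + f u * dlsubmx b 0 k.
Proof.
set v := proj_map a u; set e : 'rV[K]_n := delta_mx 0 k.
pose B := proj_den b v; pose beta := dlsubmx b 0 k.
have B0 : B != 0 by rewrite /B proj_den_inv // invr_eq0.
have betaE : beta = b (rshift n ord0) (lshift 1 k) by rewrite /beta !mxE.
(* In homogeneous coordinates the image of [v + t *: e] is [(B u + t (w + beta u), B + t beta)].
   Dividing by the last entry gives [u + s t *: w]. *)
pose w : 'rV[K]_n := \row_i proj_jac b u i k.
pose s (t : K) := t * (B + t * beta)^-1.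
pose l (t : K) := B + t * beta.
pose c (t : K) := u + s t *: w.
have dl (t : K) : is_derive t 1 l beta by exact: is_derive_affine.
have l0 : l 0 = B by rewrite /l mul0r addr0.
have ds : is_derive (0 : K) 1 s B^-1 by exact: is_derive_homography.
have s0 : s 0 = 0 by rewrite /s mul0r.
have c0 : c 0 = u by rewrite /c s0 scale0r addr0.
have ddiff (g : K -> K) d : is_derive (0 : K) 1 g d -> differentiable g (0 : K).
  by move=> [dg _]; apply/derivable1_diffP.
have dc : differentiable c (0 : K).
  by apply: differentiableD => //; apply: differentiableZl; exact: ddiff ds.
have bhv : b *m homog v = B *: homog u.
  by rewrite mulmx_homog_proj // /B proj_den_inv.
(* A projective map sends the line [v + t e] to a line through [u], which
   reduces the claim to a derivative in one variable. *)
have bhl t : b *m homog (v + t *: e) = B *: homog u + t *: (b *m col_mx e^T 0).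
  rewrite -bhv scalemxAr -mulmxDr /homog linearD linearZ /= scale_col_mx add_col_mx.
  by rewrite scaler0 addr0.
have line t : l t != 0 -> b *m homog (v + t *: e) = l t *: homog (c t).
  move=> lt0; rewrite bhl.
  have bE : b *m col_mx e^T 0 = col_mx (w^T + beta *: u^T) beta%:M.
    rewrite -{1}[b]submxK mul_block_col !mulmx0 !addr0; congr col_mx.
      apply/colP => i; rewrite !mxE (bigD1 k) //= big1 => [|j jk].
        rewrite /proj_jac !mxE !eqxx mulr1 addr0 big_ord1 !mxE.
        by rewrite -betaE [beta * _]mulrC subrK.
      by rewrite !mxE (negPf jk) andbF mulr0.
    apply/colP => i; rewrite ord1 !mxE (bigD1 k) //= big1 => [|j jk].
      by rewrite !mxE !eqxx mulr1 addr0 betaE.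
    by rewrite !mxE (negPf jk) andbF mulr0.
  rewrite bE /homog !scale_col_mx add_col_mx; congr col_mx.
    apply/colP => i; rewrite !mxE /s -/(l t) /l.
    by field.
  by apply/matrixP => i j; rewrite !ord1 !mxE eqxx /= !mulr1 mulr1n.
have pa t : l t != 0 -> proj_den a (c t) = (l t)^-1 /\ proj_map a (c t) = v + t *: e.
  move=> lt0; have h : a *m homog (c t) = (l t)^-1 *: homog (v + t *: e).
    apply: (scalerI lt0); rewrite scalerA divff // scale1r scalemxAr -line //.
    by rewrite mulmxA ab mul1mx.
  have dE := homog_inj_den h; split=> //.
  apply: homog_inj; have li0 : (l t)^-1 != 0 by rewrite invr_eq0.
  by apply: (scalerI li0); rewrite -h mulmx_homog dE.
have -> : grad ft v k = 'D_1 (fun t => l t * f (c t)) 0.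
  rewrite /grad -derive1_line derive1E; apply: near_eq_derive.
  have Vc : \forall t \near (0 : K), V (c t).
    apply: (differentiable_continuous dc); rewrite c0.
    exact: open_nbhs_nbhs.
  have ln0 : \forall t \near (0 : K), l t != 0.
    have cl : {for (0 : K), continuous l}.
      by apply: differentiable_continuous; exact: ddiff (dl 0).
    by apply: (cvgr_neq0 (l 0) cl); rewrite l0.
  near=> t; have lt0 : l t != 0 by near: t.
  have [pd pm] := pa t lt0.
  rewrite fft; last by near: t.
  by rewrite pd pm mulrA divff // mul1r.
have dfc : is_derive (0 : K) 1 (fun t => f (c t)) (B^-1 * 'D_w f u).
  have -> : (fun t => f (c t)) = (fun t => f (s t *: w + u)).
    by apply/funext => t; rewrite /c addrC.
  exact: is_derive_comp_line.
(* Product rule at 0: [l' = beta] gives the term in [f u], and [l 0 = B] cancels the derivative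
   [B^-1] of [s]. *)
have [[dl1 dl2] [dfc1 dfc2]] := (dl 0, dfc).
rewrite [LHS](deriveM dl1 dfc1) dl2 dfc2 l0 c0; congr (_ + _).
rewrite /GRing.scale /= mulrA divff // mul1r derive_grad //.
by apply: eq_bigr => i _; rewrite mxE.
Unshelve. all: by end_near. Qed.

End DensityGradient.

(** * Derivatives of the projective map and existence of regular points *)

Section ProjectiveMap.
Variables (K : numFieldType) (n : nat) (a : 'M[K]_(n + 1)).
Implicit Types (u v : 'rV[K]_n).

Lemma smooth_on_affine (V : set 'rV[K]_n) (c : 'I_n -> K) (d : K) : open V ->
  smooth_on V (fun u => \sum_(j < n) c j * u 0 j + d).
Proof.
move=> oV; apply: smooth_onD => //; last exact: smooth_on_cst.
apply: smooth_on_sum => // j _; apply: smooth_onM => //; first exact: smooth_on_cst.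
exact: smooth_on_coord.
Qed.

Lemma differentiable_affine (c : 'I_n -> K) (d : K) u :
  differentiable (fun u : 'rV[K]_n => \sum_(j < n) c j * u 0 j + d) u.
Proof. by apply: smooth_on_diff (smooth_on_affine c d openT) _. Qed.

Lemma derive_affine (c : 'I_n -> K) (d : K) u v :
  'D_v (fun u : 'rV[K]_n => \sum_(j < n) c j * u 0 j + d) u = \sum_(j < n) c j * v 0 j.
Proof.
have dcoord j : derivable (fun u : 'rV[K]_n => c j * u 0 j) u v.
  by apply: derivableM; [exact: derivable_cst|exact/diff_derivable/differentiable_coord].
rewrite [LHS]deriveD; last 2 first.
- exact: derivable_bigsum.
- exact: derivable_cst.
rewrite derive_cst addr0 derive_bigsum //; apply: eq_bigr => j _.
rewrite [LHS]deriveM; last 2 first.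
- exact: derivable_cst.
- exact/diff_derivable/differentiable_coord.
by rewrite derive_cst scaler0 addr0 derive_coord.
Qed.

(** The quotient rule in a form that keeps the ratio [f / g], which becomes [u~^k] in the Jacobian
    and [f / A] for a density. *)
Lemma derive_div (f g : 'rV[K]_n -> K) u v : g u != 0 ->
  differentiable f u -> differentiable g u ->
  'D_v (fun x => f x / g x) u = ('D_v f u - f u / g u * 'D_v g u) / g u.
Proof.
move=> g0 df dg; have [dfv dgv] := (diff_derivable (v := v) df, diff_derivable (v := v) dg).
have dV := @derivableV K _ g u v g0 dgv.
rewrite [LHS](deriveM dfv dV) (deriveV g0 dgv) /GRing.scale /=.
by field.
Qed.

Lemma differentiable_div (f g : 'rV[K]_n -> K) u : g u != 0 ->
  differentiable f u -> differentiable g u -> differentiable (fun x => f x / g x) u.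
Proof. by move=> g0 df dg; exact: differentiableM df (differentiableV dg g0). Qed.

Lemma differentiable_proj_map u k : proj_den a u != 0 ->
  differentiable (fun x => proj_map a x 0 k) u.
Proof.
move=> A0; have -> : (fun x => proj_map a x 0 k) = (fun x => proj_num a k x / proj_den a x).
  by apply/funext => x; rewrite mxE.
by apply: differentiable_div => //; exact: differentiable_affine.
Qed.

Lemma derive_proj_map u v k : proj_den a u != 0 ->
  'D_v (fun x => proj_map a x 0 k) u =
  (proj_den a u)^-1 * \sum_(j < n) proj_jac a (proj_map a u) k j * v 0 j.
Proof.
move=> A0; have -> : (fun x => proj_map a x 0 k) = (fun x => proj_num a k x / proj_den a x).
  by apply/funext => x; rewrite mxE.
rewrite derive_div //; try exact: differentiable_affine.
rewrite !derive_affine mulrC; congr (_ * _); rewrite mulr_sumr -sumrB.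
apply: eq_bigr => j _; rewrite /proj_jac !mxE big_ord1 !mxE mulrBl mulrA.
by congr (_ * _ - _ * _ * _).
Qed.

Lemma derive_div_proj_den (f : 'rV[K]_n -> K) u v : proj_den a u != 0 ->
  differentiable f u ->
  'D_v (fun x => f x / proj_den a x) u = (proj_den a u)^-1 *
    \sum_(j < n) (grad f u j - f u / proj_den a u * dlsubmx a 0 j) * v 0 j.
Proof.
move=> A0 df; rewrite derive_div //; last exact: differentiable_affine.
rewrite derive_affine derive_grad // mulrC; congr (_ * _); rewrite mulr_sumr -sumrB.
by apply: eq_bigr => j _; rewrite mulrBl !mxE mulrA.
Qed.

(** If [A] vanished at 0 and at the basis vectors, the last row of [a] would be zero. *)
Lemma exists_proj_den_neq0 : \det a = 1 -> exists u, proj_den a u != 0.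
Proof.
move=> ha; apply/not_existsP => h0.
have den0 u : proj_den a u = 0 by apply/eqP; move: (h0 u) => /negP; rewrite negbK.
have ar : a (rshift n ord0) (rshift n ord0) = 0.
  by rewrite -[RHS](den0 0) /proj_den big1 ?add0r // => j _; rewrite mxE mulr0.
have al k : a (rshift n ord0) (lshift 1 k) = 0.
  rewrite -[RHS](den0 (delta_mx 0 k)) /proj_den ar addr0 (bigD1 k) //= big1.
    by rewrite mxE !eqxx mulr1 addr0.
  by move=> j jk; rewrite mxE (negPf jk) andbF mulr0.
move: ha; rewrite (expand_det_row a (rshift n ord0)) big1 => [/esym/eqP|i _].
  by rewrite oner_eq0.
rewrite -(splitK i); case: (fintype.split i) => k /=; first by rewrite al mul0r.
by rewrite (_ : k = ord0) ?ar ?mul0r //; exact: ord1.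
Qed.

Lemma smooth_on_metric_of Om (V : set 'rV[K]_n) i j : open V ->
  smooth_on V (fun u => metric_of Om u i j).
Proof.
move=> oV; apply: smooth_on_eq (smooth_on_affine _ _ oV) => // u _.
by rewrite metric_ofE.
Qed.

(** If [A] vanishes at a point [u0] with invertible metric, moving slightly towards a point [u1]
    with [A != 0] makes [A] nonzero, while the determinant stays nonzero by continuity. *)
Lemma exists_regular Om : \det a = 1 -> (exists u, \det (metric_of Om u) != 0) ->
  exists u, proj_den a u != 0 /\ \det (metric_of Om u) != 0.
Proof.
move=> /exists_proj_den_neq0[u1 A1] [u0 D0].
have [A0|A0] := eqVneq (proj_den a u0) 0; last by exists u0.
pose c (t : K) := u0 + t *: (u1 - u0).
have cc : {for (0 : K), continuous c}.
  apply: continuousD; first exact: cst_continuous.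
  by apply: continuousZr_tmp; exact: cvg_id.
have ddet : differentiable (fun u => \det (metric_of Om u)) u0.
  apply: smooth_on_diff (_ : setT u0) => //.
  by apply: smooth_on_det openT _ => i j; exact: smooth_on_metric_of openT.
have c0 : c 0 = u0 by rewrite /c scale0r addr0.
have nD : \forall t \near (0 : K), \det (metric_of Om (c t)) != 0.
  have nD0 : nbhs (c 0) [set u | \det (metric_of Om u) != 0].
    by rewrite c0; exact: (cvgr_neq0 _ (differentiable_continuous ddet) D0).
  exact: (cc _ nD0).
have AE t : proj_den a (c t) = t * proj_den a u1.
  (* An affine function takes the value [t A(u1) + (1 - t) A(u0)] at [c t]; the second summand is
     inserted as a zero. *)
  rewrite -[RHS]addr0 -[X in _ + X](mulr0 (1 - t)) -A0 /proj_den /c !mulrDr !mulr_sumr.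
  rewrite addrACA -big_split -mulrDl [t + _]addrC subrK mul1r; congr (_ + _).
  by apply: eq_bigr => j _ /=; rewrite !mxE; ring.
have : \forall t \near (0 : K)^', \det (metric_of Om (c t)) != 0 /\ t != 0.
  near=> t; split; first by near: t; exact: nbhs_dnbhs.
  by near: t; exact: nbhs_dnbhs_neq.
move=> /filter_ex[t [Dt t0]]; exists (c t); split=> //.
by rewrite AE mulf_neq0.
Unshelve. all: by end_near. Qed.

End ProjectiveMap.

(** * Both sides of the operator identity and their difference *)

Section OperatorTransformation.
Variables (K : numFieldType) (n : nat) (a b : 'M[K]_(n + 1)).
Hypotheses (ba : b *m a = 1%:M) (ab : a *m b = 1%:M).
Variables (Om : 'I_(n + 1) -> 'I_(n + 1) -> 'I_(n + 1) -> K).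
Hypothesis sk : skew3 Om.
Variables (V : set 'rV[K]_n) (f h ft ht : 'rV[K]_n -> K).
Hypotheses (oV : open V) (VW : V `<=` regular_set a (metric_of Om)).
Hypotheses (fs : smooth_on V f) (hs : smooth_on V h).
Hypotheses (fft : density_pair a V f ft) (hht : density_pair a V h ht).

Let A := proj_den a.
Let G := metric_of Om.
Let Gt := metric_of (pullback b Om).
Let alpha := dlsubmx a.
Let beta := dlsubmx b.

Let A0 u : V u -> A u != 0. Proof. by move=> /VW[]. Qed.
Let G0 u : V u -> \det (G u) != 0. Proof. by move=> /VW[]. Qed.

Let smooth_grad g l : smooth_on V g -> smooth_on V (fun u => grad g u l).
Proof. exact: smooth_on_pderiv (ord0, l). Qed.

Let hess l m u := grad (fun x => grad h x l) u m.

Let smooth_hess l m : smooth_on V (hess l m).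
Proof. exact: smooth_on_pderiv (ord0, m) (smooth_grad l hs). Qed.

(* [flux_coef i] are the coefficients of [g^{il} D_x (dh/du^l)]. *)
Let flux_coef i m u := \sum_(l < n) invmx (G u) i l * hess l m u.

Let smooth_flux_coef i m : smooth_on V (flux_coef i m).
Proof.
apply: smooth_on_sum => // l _; apply: smooth_onM => //.
by apply: smooth_on_invmx => // k k'; exact: smooth_on_metric_of.
Qed.

Let flux i := linear_in_velocity (flux_coef i).

Let smooth_density : smooth_on V (fun u => f u / A u).
Proof.
apply: smooth_onM => //; apply: smooth_onV => //.
exact: smooth_on_affine.
Qed.

Let diffV g u : smooth_on V g -> V u -> differentiable g u.
Proof. exact: smooth_on_diff. Qed.

Let total_deriv_grad l j : V (j 0%N) ->
  total_deriv (fun j' => grad h (j' 0%N) l) j = \sum_(m < n) hess l m (j 0%N) * j 1%N 0 m.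
Proof.
move=> Vj; have dg := diffV (smooth_grad l hs) Vj.
by rewrite (total_deriv_point dg) derive_grad.
Qed.

(** Used with [c] a basis covector for [P] and with [c] a row of [M] for the new operator. *)
Let sum_flux (c : 'I_n -> K) j :
  \sum_(l < n) c l * flux l j =
  \sum_(l < n) (\sum_(i < n) c i * invmx (G (j 0%N)) i l) *
     (\sum_(m < n) hess l m (j 0%N) * j 1%N 0 m).
Proof.
under [RHS]eq_bigr do rewrite mulr_suml.
rewrite exchange_big; apply: eq_bigr => i _ /=.
rewrite /flux /linear_in_velocity /flux_coef.
under [X in _ * X = _]eq_bigr do rewrite mulr_suml.
rewrite exchange_big mulr_sumr; apply: eq_bigr => l _ /=.
by rewrite !mulr_sumr; apply: eq_bigr => m _; ring.
Qed.

Let ham_opE i j : V (j 0%N) ->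
  ham_op G (fun l j' => grad h (j' 0%N) l) i j = total_deriv (flux i) j.
Proof.
move=> Vj; apply: (eq_total_deriv oV Vj) => j' Vj'.
have -> : flux i j' = \sum_(l < n) (l == i)%:R * flux l j'.
  rewrite (bigD1 i) //= eqxx mul1r big1 ?addr0 // => l /negPf->.
  by rewrite mul0r.
rewrite sum_flux; apply: eq_bigr => l _; rewrite total_deriv_grad //.
congr (_ * _); rewrite (bigD1 i) //= eqxx mul1r big1 ?addr0 // => k /negPf->.
by rewrite mul0r.
Qed.

(** In the derivative of the formula of [grad_density], the Jacobian contributes
    [- h_i u^i_x beta_l] and the term [h beta_l] contributes its opposite, so only the Hessian terms
    survive. *)
Let total_deriv_grad_new l j : V (j 0%N) ->
  total_deriv (fun j' => grad ht (proj_map a (j' 0%N)) l) j =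
  \sum_(i < n) proj_jac b (j 0%N) i l * (\sum_(m < n) hess i m (j 0%N) * j 1%N 0 m).
Proof.
move=> Vj; set u := j 0%N; set v := j 1%N.
pose chi (x : 'rV[K]_n) := \sum_(i < n) grad h x i * proj_jac b x i l + h x * beta 0 l.
rewrite (_ : total_deriv _ j = total_deriv (fun j' => chi (j' 0%N)) j); last first.
  apply: (eq_total_deriv oV Vj) => j' Vj'.
  exact: (grad_density ba ab oV Vj' (A0 Vj') (diffV hs Vj') hht).
have dh := diffV hs Vj.
have dg i := diffV (smooth_grad i hs) Vj.
have jacE i x : proj_jac b x i l = b (lshift 1 i) (lshift 1 l) - x 0 i * beta 0 l.
  by rewrite /proj_jac !mxE big_ord1 !mxE.
have dx i : differentiable (fun x : 'rV[K]_n => x 0 i * beta 0 l) u.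
  by apply: differentiableM => //; exact: differentiable_coord.
have djac i : differentiable (fun x => proj_jac b x i l) u.
  have -> : (fun x => proj_jac b x i l) =
      cst (b (lshift 1 i) (lshift 1 l)) - (fun x : 'rV[K]_n => x 0 i * beta 0 l).
    by apply/funext => x; exact: jacE.
  exact: differentiableB.
have Djac i : 'D_v (fun x => proj_jac b x i l) u = - (v 0 i * beta 0 l).
  have -> : (fun x => proj_jac b x i l) =
      cst (b (lshift 1 i) (lshift 1 l)) - (fun x : 'rV[K]_n => x 0 i * beta 0 l).
    by apply/funext => x; exact: jacE.
  rewrite deriveB; last 2 first.
  - exact: derivable_cst.
  - exact: diff_derivable.
  rewrite derive_cst sub0r; congr (- _).
  have dc : derivable (fun x : 'rV[K]_n => x 0 i) u v.
    exact/diff_derivable/differentiable_coord.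
  rewrite [LHS](deriveM dc (derivable_cst (beta 0 l) u v)) derive_cst derive_coord.
  by rewrite scaler0 add0r mulrC.
have dsum : differentiable (fun x => \sum_(i < n) grad h x i * proj_jac b x i l) u.
  have -> : (fun x => \sum_(i < n) grad h x i * proj_jac b x i l) =
      \sum_(i < n) (fun x => grad h x i * proj_jac b x i l).
    by apply/funext => x; rewrite fct_sumE.
  by apply: differentiable_sum => i; exact: differentiableM.
have dhb : differentiable (fun x => h x * beta 0 l) u by exact: differentiableM.
rewrite total_deriv_point; last exact: differentiableD dsum dhb.
rewrite [LHS](deriveD (diff_derivable dsum) (diff_derivable dhb)).
rewrite derive_bigsumM; last 2 first.
- by move=> i; exact: diff_derivable.
- by move=> i; exact: diff_derivable.
have -> : 'D_v (fun x => h x * beta 0 l) u = \sum_(i < n) grad h u i * (v 0 i * beta 0 l).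
  rewrite [LHS](deriveM (diff_derivable dh) (derivable_cst (beta 0 l) u v)) derive_cst.
  rewrite scaler0 add0r derive_grad // /GRing.scale /= mulr_sumr.
  by apply: eq_bigr => i _; ring.
rewrite -big_split; apply: eq_bigr => i _ /=.
rewrite Djac (derive_grad _ (dg i)) -/(hess i _ _).
rewrite [X in X + _ + _]mulrC -addrA mulrN addNr addr0.
by [].
Qed.

(** The factor [A^-1] of the inner derivative cancels the [A] of [inv_metric_of_pullback]; that of
    the outer derivative stays in front. *)
Let ham_op_newE k j : V (j 0%N) ->
  ham_op_new a Gt (fun l j' => grad ht (proj_map a (j' 0%N)) l) k j =
  (A (j 0%N))^-1 * total_deriv (fun j' =>
    \sum_(i < n) proj_jac a (proj_map a (j' 0%N)) k i * flux i j') j.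
Proof.
move=> Vj; rewrite /ham_op_new /second_order_op /total_deriv_new; congr (_ * _).
apply: (eq_total_deriv oV Vj) => j' Vj'.
set u := j' 0%N; have Au0 := A0 Vj'.
have /(congr1 (fun M => (A u)^-1 *: M)) := inv_metric_of_pullback ba Au0 sk (G0 Vj').
rewrite scalerA mulVf // scale1r => E.
transitivity (\sum_(l < n) ((A u)^-1 *: (invmx (Gt (proj_map a u)) *m (proj_jac b u)^T)) k l
   * (\sum_(m < n) hess l m u * j' 1%N 0 m)); last first.
  by rewrite E sum_flux; apply: eq_bigr => l _; rewrite mxE.
under eq_bigr do rewrite total_deriv_grad_new //.
under [RHS]eq_bigr do
  rewrite [X in X * _]mxE [X in _ * X * _]mxE [X in X * _]mulr_sumr mulr_suml.
rewrite exchange_big; apply: eq_bigr => l _ /=.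
rewrite mulrA mulr_sumr; apply: eq_bigr => i _.
by rewrite [(_^T) l i]mxE -/(A _) -/u; ring.
Qed.

Let potential (j : jet K n) := \sum_(i < n) (f (j 0%N) / A (j 0%N) * alpha 0 i) * flux i j.

Let differential_potential : differential_fun V potential.
Proof.
(* The potential has order one, so truncated jets have two rows: [ord0] is [u] and [ord_max] is
   [u_x]. *)
exists 1%N; pose W := [set x : 'M[K]_(2, n) | V (row ord0 x)].
have oW : open W by exact: open_row_preimage.
exists (fun x : 'M[K]_(2, n) => \sum_(i < n) (f (row ord0 x) / A (row ord0 x) * alpha 0 i)
  * \sum_(m < n) flux_coef i m (row ord0 x) * x ord_max m).
  apply: smooth_on_sum => // i _; apply: smooth_onM => //.
    apply: smooth_onM => //; last exact: smooth_on_cst.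
    exact: (smooth_on_comp_row oV smooth_density).
  apply: smooth_on_sum => // m _; apply: smooth_onM => //; last exact: smooth_on_coord.
  exact: (smooth_on_comp_row oV (smooth_flux_coef i m)).
move=> j Vj; have rE : row ord0 (jet_trunc 1 j) = j 0%N.
  by apply/rowP => m; rewrite !mxE.
rewrite rE; apply: eq_bigr => i _; congr (_ * _).
by apply: eq_bigr => m _; rewrite !mxE.
Qed.

(** With [q = f / A], the coefficient of [D_x W^i] in the difference is
    [f_i - f~_k M^k_i = q alpha_i]. That of [W^i] is [f~_k (D_x u~^k) alpha_i = (D_x q) alpha_i],
    because [D_x M^k_i = - (D_x u~^k) alpha_i]. Together they are [D_x (q alpha_i W^i)]. *)
Lemma is_total_deriv_difference :
  is_total_deriv V (fun j =>
      \sum_(i < n) grad f (j 0%N) i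
         * ham_op G (fun l j' => grad h (j' 0%N) l) i j
      - proj_den a (j 0%N) *
        \sum_(k < n) grad ft (proj_map a (j 0%N)) k
         * ham_op_new a Gt (fun l j' => grad ht (proj_map a (j' 0%N)) l) k j).
Proof.
exists potential => // j Vj; have Au0 := A0 Vj.
under eq_bigr do rewrite ham_opE //.
under [X in _ - _ * X]eq_bigr do rewrite ham_op_newE //.
set u := j 0%N in Vj Au0 *; set v := j 1%N.
have dF i m : differentiable (flux_coef i m) u by exact: diffV.
have dfA : differentiable (fun x => f x / A x) u by exact: diffV.
set q := f u / A u.
pose psi k := grad ft (proj_map a u) k; pose M := proj_jac a (proj_map a u).
pose d k := 'D_v (fun x => proj_map a x 0 k) u.
have psiM i : \sum_(k < n) psi k * M k i = grad f u i - q * alpha 0 i.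
  pose gf := \row_i grad f u i.
  have psiE : \row_k psi k = gf *m proj_jac b u + f u *: beta.
    apply/rowP => k; rewrite mxE /psi (grad_density ba ab oV Vj Au0 (diffV fs Vj) fft).
    rewrite [RHS]mxE [X in _ = X + _]mxE [X in _ = _ + X]mxE; congr (_ + _).
    by apply: eq_bigr => l _; rewrite [gf _ _]mxE.
  have : (\row_k psi k) *m M = gf - q *: alpha.
    rewrite psiE mulmxDl -mulmxA (mul_proj_jac ba Au0) mulmx1 -scalemxAl.
    by rewrite (mul_dlsub_proj_jac ba Au0) scalerN scalerA.
  move=> /rowP/(_ i); rewrite mxE; under eq_bigr do rewrite [X in X * _]mxE.
  by move=> ->; rewrite [LHS]mxE [X in X + _]mxE [X in _ + X]mxE [X in _ - X]mxE.
(* This is the chain rule for [f / A = ft o proj_map], obtained from explicit formulas since [ft] is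
   not known to be differentiable. *)
have psid : \sum_(k < n) psi k * d k = 'D_v (fun x => f x / A x) u.
  rewrite derive_div_proj_den //; last exact: diffV.
  rewrite /d; under eq_bigr do rewrite derive_proj_map // mulrCA mulr_sumr.
  rewrite -mulr_sumr; congr (_ * _); rewrite exchange_big; apply: eq_bigr => l _ /=.
  rewrite -psiM mulr_suml; apply: eq_bigr => k _; exact: mulrA.
pose X i := flux i j; pose DX i := total_deriv (flux i) j.
have DY k : total_deriv (fun j' =>
    \sum_(i < n) proj_jac a (proj_map a (j' 0%N)) k i * flux i j') j =
    \sum_(i < n) (- (d k * alpha 0 i) * X i + M k i * DX i).
  have jacE i x : proj_jac a (proj_map a x) k i =
      a (lshift 1 k) (lshift 1 i) - proj_map a x 0 k * alpha 0 i.
    rewrite /proj_jac mxE [X in X + _]mxE [X in X + _]mxE [X in _ + X]mxE.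
    by rewrite [X in - X]mxE big_ord1 [X in X * _]mxE.
  have dp : differentiable (fun x => proj_map a x 0 k) u by exact: differentiable_proj_map.
  have dpa i : differentiable (fun x => proj_map a x 0 k * alpha 0 i) u.
    exact: differentiableM.
  have jacF i : (fun x => proj_jac a (proj_map a x) k i) =
      cst (a (lshift 1 k) (lshift 1 i)) - (fun x => proj_map a x 0 k * alpha 0 i).
    by apply/funext => x; exact: jacE.
  rewrite (@total_deriv_velocityM _ _ _ (fun i x => proj_jac a (proj_map a x) k i)); last 2 first.
  - by move=> i; rewrite jacF; exact: differentiableB.
  - by [].
  apply: eq_bigr => i _; congr (_ * _ + _).
  rewrite jacF deriveB; last 2 first.
  - exact: derivable_cst.
  - exact: diff_derivable.
  rewrite derive_cst sub0r; congr (- _).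
  rewrite [LHS](deriveM (diff_derivable dp) (derivable_cst (alpha 0 i) u v)) derive_cst.
  by rewrite scaler0 add0r mulrC.
(* The factor [A] from [dx~ = A dx] cancels the remaining [A^-1] of the outer derivative. *)
under [X in _ - _ * X]eq_bigr do rewrite DY mulrCA.
rewrite -mulr_sumr mulrA divff // mul1r.
rewrite (@total_deriv_velocityM _ _ _ (fun i x => f x / A x * alpha 0 i)) //; last first.
  by move=> i; exact: differentiableM.
under [X in _ - X]eq_bigr do rewrite mulr_sumr.
rewrite exchange_big -sumrB; apply: eq_bigr => i _ /=.
have -> : 'D_v (fun x => f x / A x * alpha 0 i) u = 'D_v (fun x => f x / A x) u * alpha 0 i.
  rewrite [LHS](deriveM (diff_derivable dfA) (derivable_cst (alpha 0 i) u v)) derive_cst.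
  by rewrite scaler0 add0r; exact: mulrC.
have -> : \sum_(k < n) psi k * (- (d k * alpha 0 i) * X i + M k i * DX i) =
    - (\sum_(k < n) psi k * d k) * (alpha 0 i * X i) + (\sum_(k < n) psi k * M k i) * DX i.
  rewrite -sumrN !mulr_suml -big_split; apply: eq_bigr => k _ /=.
  by ring.
rewrite psid psiM -/(X i) -/(DX i) -/u -/q.
have -> : linear_in_velocity (flux_coef i) j = X i by [].
by ring.
Qed.

End OperatorTransformation.

(** * Invariance of the canonical form *)

Theorem theorem1 (R : realType) (n : nat)
    (G : 'rV[R[i]]_n -> 'M[R[i]]_n) (a : 'M[R[i]]_(n + 1))
    (hG : canonical_metric G) (ha : \det a = 1) :
  exists Gt : 'rV[R[i]]_n -> 'M[R[i]]_n,
    [/\ canonical_metric Gt,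
        (forall u, regular_set a G u -> \det (Gt (proj_map a u)) != 0) &
        op_transformed a (regular_set a G) (ham_op G) (ham_op_new a Gt)].
Proof.
have [[T [g0 [skT skg GE]]] detG] := hG.
pose Om := homog_form T g0; have skO : skew3 Om := skew3_homog_form skT skg.
have GO : G = metric_of Om.
  apply/funext => u; apply/matrixP => i j.
  by rewrite GE metric_of_homog_form.
have au : a \in unitmx by rewrite unitmxE ha unitr1.
have [ba ab] := (mulVmx au, mulmxV au).
rewrite GO in detG *.
(* The image of such a point witnesses the non-degeneracy of the new metric. *)
have [u0 [A0 D0]] := exists_regular ha detG.
exists (metric_of (pullback (invmx a) Om)); split.
- apply: canonical_metric_of; first exact: skew3_pullback.
  by exists (proj_map a u0); exact: det_metric_of_pullback.
- by move=> u [Au Du]; exact: det_metric_of_pullback.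
- by move=> V f h ft ht oV VW fs hs fft hht; exact: is_total_deriv_difference.
Qed.
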